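(* Let $(\mathbf a,\mathbf b)$ be a Legendre pair of length $\ell=5m$, with $\ell$ odd and $\sum_i a_i=\sum_i b_i=1$, and let $\mathcal A_m=[A_0,\ldots,A_4]$, $\mathcal B_m=[B_0,\ldots,B_4]$ be the $m$-compressions of $\mathbf a,\mathbf b$. Then the following two conditions are equivalent: (i) for some nonnegative integer $x\equiv-(\ell+1)\equiv \ell+1\pmod 4$, $$\mathrm{PSD}_{\mathbf a}(rm)=\ell+1+(-1)^{\lfloor r/2\rfloor}\sqrt5\,x,\qquad \mathrm{PSD}_{\mathbf b}(rm)=\ell+1-(-1)^{\lfloor r/2\rfloor}\sqrt5\,x\qquad\text{for } r=1,\ldots,4;$$ (ii) $p_2(\mathcal A_m)=\mathrm{PAF}_{\mathcal A_m}(0)=p_2(\mathcal B_m)=\mathrm{PAF}_{\mathcal B_m}(0)=4m+1$.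
   Context: For $\mathbf a\in\mathbb{R}^N$ indexed by $\mathbb{Z}_N$: $\mathrm{PAF}_{\mathbf a}(j)=\sum_{i=0}^{N-1}a_i a_{i-j}$ (indices mod $N$), $\mathrm{DFT}_{\mathbf a}(j)=\sum_{r=0}^{N-1}e^{2\pi i jr/N}a_r$, $\mathrm{PSD}_{\mathbf a}(j)=|\mathrm{DFT}_{\mathbf a}(j)|^2$, and $p_2(\mathbf a)=\sum_i a_i^2$. A pair $(\mathbf a,\mathbf b)$ of vectors in $\{-1,1\}^\ell$ is a Legendre pair of length $\ell$ if $\mathrm{PAF}_{\mathbf a}(j)+\mathrm{PAF}_{\mathbf b}(j)=-2$ for all $j\in\mathbb{Z}_\ell\setminus\{0\}$ and $\sum_i a_i=\sum_i b_i$. For $\ell=nm$, the $m$-compression of $\mathbf a\in\mathbb{R}^\ell$ is $\mathcal A_m=[A_0,\ldots,A_{n-1}]$ with $A_j=\sum_{i=0}^{m-1}a_{ni+j}$ (here $n=5$).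
   Formalization: In (i) the PSD formulas are required to hold for (a,b) or with a and b interchanged; as printed, (ii) ⇒ (i) fails with x nonnegative, e.g. for ℓ=5, a=(1,1,-1,1,-1), b=(1,1,1,-1,-1), where x would be -2. *)

(* Defs.v *)
From HB Require Import structures.
From mathcomp Require Import all_boot all_order all_algebra.
From mathcomp Require Import reals trigo.
From mathcomp Require Export complex.
Set Implicit Arguments.
Unset Strict Implicit.
Unset Printing Implicit Defensive.
Import Order.TTheory GRing.Theory Num.Theory.
Local Open Scope ring_scope.
Local Open Scope complex_scope.

(* The entry of a with index k read modulo N.  The default 0 is only reached
   when N = 0, since k %% N < N otherwise. *)
Definition cyc (R : realType) (N : nat) (a : 'rV[R]_N) (k : nat) : R :=
  oapp (fun i : 'I_N => a 0 i) 0 (insub (k %% N)%N).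

(* i + (N - j) represents i - j modulo N without truncation, because j < N. *)
Definition PAF (R : realType) (N : nat) (a : 'rV[R]_N) (j : 'I_N) : R :=
  \sum_(i < N) a 0 i * cyc a (i + (N - j))%N.

Definition cexpi (R : realType) (t : R) : R[i] := cos t +i* sin t.

(* The frequency j in Z_N is given by any natural number representing it. *)
Definition DFT (R : realType) (N : nat) (a : 'rV[R]_N) (j : nat) : R[i] :=
  \sum_(r < N) cexpi (2 * pi * j%:R * r%:R / N%:R) * (a 0 r)%:C.

Definition PSD (R : realType) (N : nat) (a : 'rV[R]_N) (j : nat) : R :=
  Normc.normc (DFT a j) ^+ 2.

Definition p2 (R : realType) (N : nat) (a : 'rV[R]_N) : R :=
  \sum_(i < N) a 0 i ^+ 2.

Definition legendre_pair (R : realType) (l : nat) (a b : 'rV[R]_l) : Prop :=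
  [/\ forall i : 'I_l, a 0 i = 1 \/ a 0 i = -1,
      forall i : 'I_l, b 0 i = 1 \/ b 0 i = -1,
      forall j : 'I_l, (j : nat) <> 0%N -> PAF a j + PAF b j = - 2
    & \sum_(i < l) a 0 i = \sum_(i < l) b 0 i].

(* All indices n * i + j below are smaller than n * m, so that cyc does not
   wrap around here. *)
Definition compression (R : realType) (n m : nat) (a : 'rV[R]_(n * m)) :
    'rV[R]_n :=
  \row_(j < n) \sum_(i < m) cyc a (n * i + j)%N.

(* Main.v *)
(** Since DFT_a (r m) = DFT_A (r) for the compression A of a, everything takes
    place in length 5, where PSD_A (r) = p_2 (A) + 2 cos(t) PAF_A (1)
    + 2 cos(2t) PAF_A (2) with t = 2 pi r / 5.  As cos (2 pi / 5) = (sqrt 5 - 1) / 4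
    and p_2 (A) + 2 PAF_A (1) + 2 PAF_A (2) = (sum A)^2 = 1, this equals
    (5 p_2 (A) - 1) / 4 + (-1)^(r/2) sqrt 5 (PAF_A (1) - PAF_A (2)) / 2.
    Adding the values at r = 1 and r = 2 gives (i) => (ii).  Conversely, the
    Legendre condition compresses to PAF_A + PAF_B = - 2 m off 0, so under (ii) the
    coefficient of sqrt 5 is y = PAF_A (1) + m for A and - y for B.  The entries of
    A are odd and sum to 1, so PAF_A (1) = 1 mod 4 and x = |y| works. *)

Require Import Defs.
From mathcomp Require Import all_boot all_order all_algebra.
From mathcomp Require Import reals trigo.
From mathcomp Require Import ring lra zify.
Import Order.TTheory GRing.Theory Num.Theory.
Local Open Scope ring_scope.

(** * Cyclic indexing, residue classes and autocorrelation of compressions *)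

Lemma cycE (R : realType) (N : nat) (a : 'rV[R]_N) (i : 'I_N) : cyc a i = a 0 i.
Proof. by rewrite /cyc modn_small // valK. Qed.

Lemma cycDM (R : realType) (N : nat) (a : 'rV[R]_N) (k q : nat) :
  cyc a (k + N * q)%N = cyc a k.
Proof. by rewrite /cyc [(N * q)%N]mulnC addnC modnMDl. Qed.

Lemma cyc_ind (R : realType) (N : nat) (a : 'rV[R]_N) (P : R -> Prop) (k : nat) :
  (0 < N)%N -> (forall i, P (a 0 i)) -> P (cyc a k).
Proof.
move=> N_gt0 Pa; rewrite /cyc.
by case: insubP => /= [*|]; rewrite ?ltn_mod ?N_gt0.
Qed.

Lemma sum_residues (V : nmodType) (n m : nat) (F : nat -> V) :
  \sum_(i < n * m) F i = \sum_(k < n) \sum_(i < m) F (n * i + k)%N.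
Proof.
rewrite exchange_big; elim: m => [|m IHm]; first by rewrite muln0 !big_ord0.
by rewrite mulnSr big_split_ord big_ord_recr IHm.
Qed.

Lemma cyc_compression (R : realType) (n m : nat) (a : 'rV[R]_(n * m)) (k : nat) :
  (0 < n)%N -> cyc (compression a) k = \sum_(i < m) cyc a (n * i + k)%N.
Proof.
move=> n_gt0; pose g k := \sum_(i < m) cyc a (n * i + k)%N.
have gDn j : g (j + n)%N = g j.
  (* Both sides are the sum of [m.+1] entries in steps of [n] from [j], split off at its first or
     its last term; the last index [n * m + j] wraps round to [j]. *)
  have : g (j + n)%N + cyc a j = g j + cyc a j.
    transitivity (\sum_(i < m.+1) cyc a (n * i + j)%N).
      rewrite big_ord_recl /= muln0 add0n addrC; congr (_ + _).
      apply: eq_bigr => i _; congr cyc; rewrite /bump /=; nia.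
    by rewrite big_ord_recr /= -(cycDM _ _ _ j 1) muln1 [(j + _)%N]addnC.
  exact: addIr.
have gDM q j : g (q * n + j)%N = g j.
  by elim: q => // q IHq; rewrite mulSn -addnA addnC gDn.
rewrite -/(g k) {2}(divn_eq k n) gDM /cyc; case: insubP; rewrite ?ltn_mod ?n_gt0 //=.
by move=> i _ <-; rewrite mxE.
Qed.

Lemma sum_compression (R : realType) (n m : nat) (a : 'rV[R]_(n * m)) :
  \sum_(k < n) compression a 0 k = \sum_(i < n * m) a 0 i.
Proof.
under [RHS]eq_bigr do rewrite -cycE.
by rewrite sum_residues; apply: eq_bigr => k _; rewrite mxE.
Qed.

Lemma p2_PAF0 (R : realType) (N : nat) (a : 'rV[R]_N.+1) : p2 a = PAF a ord0.
Proof.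
apply: eq_bigr => i _.
by rewrite subn0 -[X in (i + X)%N]muln1 cycDM cycE expr2.
Qed.

(* The entries of [a] in the residue class of [i - j] modulo [n] are exactly
   those with index [i - (n k + j)], [k < m]. *)
Lemma PAF_compression (R : realType) (n m : nat) (a : 'rV[R]_(n * m))
    (j : 'I_n) (J : 'I_m -> 'I_(n * m)) :
  (forall k : 'I_m, J k = (n * k + j)%N :> nat) ->
  PAF (compression a) j = \sum_(k < m) PAF a (J k).
Proof.
move=> JE; have n_gt0 : (0 < n)%N := leq_ltn_trans (leq0n j) (ltn_ord j).
have classE u : cyc (compression a) (u + (n - j))%N =
    \sum_(k < m) cyc a (u + (n * m - J k))%N.
  (* Reversal turns [i] into [m - 1 - k], and [n * (m - 1 - k) + (n - j)] is
     [n * m - (n * k + j)]. *)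
  rewrite cyc_compression // (reindex_inj rev_ord_inj) /=.
  apply: eq_bigr => k _; rewrite JE; congr cyc.
  by have := ltn_ord k; have := ltn_ord j; nia.
under [RHS]eq_bigr do (rewrite /PAF; under eq_bigr do rewrite -cycE).
rewrite exchange_big /=.
under [RHS]eq_bigr do rewrite -mulr_sumr -classE.
rewrite (sum_residues _ n m
  (fun u => cyc a u * cyc (compression a) (u + (n - j))%N)).
apply: eq_bigr => k _; rewrite mxE mulr_suml; apply: eq_bigr => i _.
by rewrite -addnA [X in _ = _ * cyc _ X]addnC cycDM.
Qed.

(** None of the [m] shifts [n * k + j] is zero when [j] is not, so each contributes [c]. *)
Lemma PAFD_compression (R : realType) (n m : nat) (a b : 'rV[R]_(n * m)) (c : R)
    (j : 'I_n) :
  (forall i : 'I_(n * m), i <> 0%N :> nat -> PAF a i + PAF b i = c) ->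
  j != 0%N :> nat ->
  PAF (compression a) j + PAF (compression b) j = c *+ m.
Proof.
move=> PAFab j_neq0.
have ltJ (k : 'I_m) : (n * k + j < n * m)%N.
  by have := ltn_ord k; have := ltn_ord j; nia.
pose J k := Ordinal (ltJ k).
rewrite !(PAF_compression _ _ _ _ _ J) // -big_split /=.
rewrite (eq_bigr (fun=> c)) ?sumr_const ?card_ord // => k _.
by apply: PAFab => /=; lia.
Qed.

(** * Power spectral density in real terms *)

Lemma PSD_cos_sin (R : realType) (N : nat) (a : 'rV[R]_N) (j : nat) :
  PSD a j = (\sum_(k < N) cos (2 * pi * j%:R * k%:R / N%:R) * a 0 k) ^+ 2
          + (\sum_(k < N) sin (2 * pi * j%:R * k%:R / N%:R) * a 0 k) ^+ 2.
Proof.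
rewrite /PSD; set C := \sum_(k < N) _; set S := \sum_(k < N) _.
have -> : DFT a j = (C +i* S)%C.
  rewrite /DFT /C /S; elim/big_ind3: _ => //.
    by move=> ? ? ? ? ? ? -> ->.
  move=> k _; apply/eqP.
  by rewrite eq_complex /= !mulr0 subr0 add0r !eqxx.
by rewrite sqr_sqrtr // addr_ge0 ?sqr_ge0.
Qed.

Lemma cosD2piMn (R : realType) (x : R) (q : nat) : cos (2 * pi * q%:R + x) = cos x.
Proof.
by rewrite -[RHS](periodicn (@cosD2pi R) q); congr cos; rewrite -mulr_natr; ring.
Qed.

Lemma sinD2piMn (R : realType) (x : R) (q : nat) : sin (2 * pi * q%:R + x) = sin x.
Proof.
by rewrite -[RHS](periodicn (@sinD2pi R) q); congr sin; rewrite -mulr_natr; ring.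
Qed.

(** At frequency [r * m] the angles along a residue class modulo [n] differ by full turns, so cosine
    and sine factor out of each class. *)
Lemma PSD_compression (R : realType) (n m : nat) (a : 'rV[R]_(n * m)) (r : nat) :
  (0 < n)%N -> (0 < m)%N -> PSD a (r * m) = PSD (compression a) r.
Proof.
move=> n_gt0 m_gt0; rewrite !PSD_cos_sin.
have angleE i k : 2 * pi * (r * m)%:R * (n * i + k)%:R / (n * m)%:R =
    2 * pi * (r * i)%:R + 2 * pi * r%:R * k%:R / n%:R :> R.
  rewrite !natrM natrD natrM; field.
  by rewrite !pnatr_eq0 -!lt0n n_gt0.
have sumE (f : R -> R) : (forall x q, f (2 * pi * q%:R + x) = f x) ->
    \sum_(i < n * m) f (2 * pi * (r * m)%:R * i%:R / (n * m)%:R) * a 0 i =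
    \sum_(k < n) f (2 * pi * r%:R * k%:R / n%:R) * compression a 0 k.
  move=> f_per; under eq_bigr do rewrite -cycE.
  rewrite (sum_residues _ n m (fun i =>
    f (2 * pi * (r * m)%:R * i%:R / (n * m)%:R) * cyc a i)).
  apply: eq_bigr => k _; rewrite mxE mulr_sumr; apply: eq_bigr => i _.
  by rewrite angleE f_per.
by rewrite !sumE //; [exact: sinD2piMn|exact: cosD2piMn].
Qed.

(** * Explicit formulas in length 5 *)

Lemma sum_row5 (R : realType) (v : 'rV[R]_5) (F : 'I_5 -> R -> R) :
  \sum_(k < 5) F k (v 0 k) =
  F 0 (cyc v 0) + F 1 (cyc v 1) + F 2 (cyc v 2) + F 3 (cyc v 3) + F 4 (cyc v 4).
Proof.
under eq_bigr do rewrite -cycE.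
rewrite !big_ord_recr big_ord0 /= add0r.
by congr (F _ _ + F _ _ + F _ _ + F _ _ + F _ _); apply: val_inj.
Qed.

Lemma PAF5_1 (R : realType) (v : 'rV[R]_5) :
  PAF v 1 = cyc v 0 * cyc v 4 + cyc v 1 * cyc v 0 + cyc v 2 * cyc v 1
          + cyc v 3 * cyc v 2 + cyc v 4 * cyc v 3.
(* Shifting by -1 is adding 4; indices beyond 4 are reduced by computation inside [cyc]. *)
Proof. exact: (sum_row5 _ v (fun i x => x * cyc v (i + 4))). Qed.

Lemma PAF5_2 (R : realType) (v : 'rV[R]_5) :
  PAF v 2 = cyc v 0 * cyc v 3 + cyc v 1 * cyc v 4 + cyc v 2 * cyc v 0
          + cyc v 3 * cyc v 1 + cyc v 4 * cyc v 2.
Proof. exact: (sum_row5 _ v (fun i x => x * cyc v (i + 3))). Qed.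

Lemma p2_5 (R : realType) (v : 'rV[R]_5) :
  p2 v = cyc v 0 ^+ 2 + cyc v 1 ^+ 2 + cyc v 2 ^+ 2 + cyc v 3 ^+ 2 + cyc v 4 ^+ 2.
Proof. exact: (sum_row5 _ v (fun=> fun x => x ^+ 2)). Qed.

Lemma sqr_sum5 (R : realType) (v : 'rV[R]_5) :
  (\sum_(k < 5) v 0 k) ^+ 2 = p2 v + 2 * PAF v 1 + 2 * PAF v 2.
Proof.
by rewrite (sum_row5 _ v (fun=> id)) p2_5 PAF5_1 PAF5_2; ring.
Qed.

(** The product of entries [i] and [j] has coefficient 2 cos((i - j) t), which depends only on their
    cyclic distance, 1 or 2, because 5 t is a multiple of 2 pi. *)
Lemma PSD5 (R : realType) (v : 'rV[R]_5) (r : nat) :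
  let t := 2 * pi * r%:R / 5 in
  PSD v r = p2 v + 2 * cos t * PAF v 1 + 2 * cos (2 * t) * PAF v 2.
Proof.
move=> t; rewrite PSD_cos_sin.
rewrite (sum_row5 _ v (fun k x => cos (2 * pi * r%:R * k%:R / 5%:R) * x)).
rewrite (sum_row5 _ v (fun k x => sin (2 * pi * r%:R * k%:R / 5%:R) * x)) /=.
have -> : 2 * pi * r%:R * 0%:R / 5%:R = 0 :> R by rewrite mulr0 mul0r.
have -> : 2 * pi * r%:R * 1%:R / 5%:R = t by rewrite mulr1.
have -> : 2 * pi * r%:R * 2%:R / 5%:R = 2 * t by rewrite /t; field.
have -> : 2 * pi * r%:R * 3%:R / 5%:R = 2 * pi * r%:R + - (2 * t) by rewrite /t; field.
have -> : 2 * pi * r%:R * 4%:R / 5%:R = 2 * pi * r%:R + - t by rewrite /t; field.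
rewrite !cosD2piMn !sinD2piMn !cosN !sinN cos0 sin0 p2_5 PAF5_1 PAF5_2.
have cos1E : cos (2 * t) * cos t + sin (2 * t) * sin t = cos t.
  by rewrite -cosB; congr cos; ring.
have cos2E : cos t * cos t - sin t * sin t = cos (2 * t).
  by rewrite -cosD; congr cos; ring.
(* The angle 3 t is -2 t up to [r] full turns; likewise 4 t is -t below. *)
have cos3E : cos (2 * t) * cos t - sin (2 * t) * sin t = cos (2 * t).
  rewrite -cosD -[RHS]cosN -[RHS](cosD2piMn _ _ r); congr cos.
  by rewrite /t; field.
have cos4E : cos (2 * t) * cos (2 * t) - sin (2 * t) * sin (2 * t) = cos t.
  rewrite -cosD -[RHS]cosN -[RHS](cosD2piMn _ _ r); congr cos.
  by rewrite /t; field.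
have := cos2Dsin2 t; have := cos2Dsin2 (2 * t).
move: (cos t) (sin t) (cos (2 * t)) (sin (2 * t)) cos1E cos2E cos3E cos4E.
move: (cyc v 0) (cyc v 1) (cyc v 2) (cyc v 3) (cyc v 4) => x0 x1 x2 x3 x4.
move=> c s c' s' cos1E cos2E cos3E cos4E norm' norm.
transitivity (x0 ^+ 2 + (c ^+ 2 + s ^+ 2) * (x1 ^+ 2 + x4 ^+ 2)
  + (c' ^+ 2 + s' ^+ 2) * (x2 ^+ 2 + x3 ^+ 2)
  + 2 * (c * (x0 * x1 + x0 * x4) + c' * (x0 * x2 + x0 * x3)
    + (c' * c + s' * s) * (x1 * x2 + x3 * x4)
    + (c * c - s * s) * (x1 * x4)
    + (c' * c - s' * s) * (x1 * x3 + x2 * x4)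
    + (c' * c' - s' * s') * (x2 * x3))); first by ring.
by rewrite norm norm' cos1E cos2E cos3E cos4E; ring.
Qed.

(** * Cosines of multiples of 2 pi / 5 *)

Lemma cos_2pi5 (R : realType) : cos (2 * pi / 5) = (Num.sqrt 5 - 1) / 4 :> R.
Proof.
set t : R := 2 * pi / 5; have pi_pos : 0 < pi :> R := pi_gt0 R.
have c_gt0 : 0 < cos t by apply: cos_gt0_pihalf; rewrite /t; lra.
have s_gt0 : 0 < sin t by apply: sin_gt0_pi; rewrite /t; lra.
have c_lt1 : cos t < 1 by have := cos2Dsin2 t; nra.
have cos2E : cos (2 * t) = 2 * cos t ^+ 2 - 1.
  by rewrite (mulr_natl t) cos_mulr2n; ring.
have sin2E : sin (2 * t) = 2 * cos t * sin t.
  by rewrite (mulr_natl t) sin_mulr2n; ring.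
have : cos (2 * t) * cos t - sin (2 * t) * sin t = cos (2 * t).
  rewrite -cosD -[RHS]cosN -[RHS](cosD2piMn _ _ 1); congr cos.
  by rewrite /t; field.
rewrite cos2E sin2E => cos3E.
(* This is cos(3 t) = cos(2 t) as a cubic in cos t. The quadratic factor says (4 cos t + 1)^2 = 5,
   and positivity of cos t selects the root. *)
have /eqP : (cos t - 1) * (4 * cos t ^+ 2 + 2 * cos t - 1) = 0.
  by have := cos2Dsin2 t; nra.
rewrite mulf_eq0 subr_eq0 (lt_eqF c_lt1) /= => /eqP quad.
have -> : 5 = (4 * cos t + 1) ^+ 2 :> R by lra.
by rewrite sqrtr_sqr ger0_norm; lra.
Qed.

Lemma cos_2pi5Mn (R : realType) (r : nat) : (1 <= r <= 4)%N ->
  let t := 2 * pi * r%:R / 5 in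
  cos t = ((-1) ^+ (r %/ 2) * Num.sqrt 5 - 1) / 4 :> R /\
  cos (2 * t) = (- (-1) ^+ (r %/ 2) * Num.sqrt 5 - 1) / 4 :> R.
Proof.
have c1 := cos_2pi5 R; have sqrt5 : Num.sqrt 5 ^+ 2 = 5 :> R by rewrite sqr_sqrtr.
have c2 : cos (4 * pi / 5) = (- Num.sqrt 5 - 1) / 4 :> R.
  have -> : 4 * pi / 5 = (2 * pi / 5) *+ 2 :> R by rewrite -mulr_natl; field.
  by rewrite cos_mulr2n c1; lra.
have c3 : cos (6 * pi / 5) = cos (4 * pi / 5) :> R.
  by rewrite -[RHS]cosN -[RHS](cosD2piMn _ _ 1); congr cos; field.
have c4 : cos (8 * pi / 5) = cos (2 * pi / 5) :> R.
  by rewrite -[RHS]cosN -[RHS](cosD2piMn _ _ 1); congr cos; field.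
have c6 : cos (12 * pi / 5) = cos (2 * pi / 5) :> R.
  by rewrite -[RHS](cosD2piMn _ _ 1); congr cos; field.
have c8 : cos (16 * pi / 5) = cos (4 * pi / 5) :> R.
  by rewrite -[RHS]cosN -[RHS](cosD2piMn _ _ 2); congr cos; field.
case: r => [|[|[|[|[|]]]]] //= _.
- rewrite mulr1 c1 (_ : 2 * (2 * pi / 5) = 4 * pi / 5); last by field.
  by rewrite c2; split; field.
- rewrite (_ : 2 * pi * 2 / 5 = 4 * pi / 5); last by field.
  rewrite (_ : 2 * (4 * pi / 5) = 8 * pi / 5); last by field.
  by rewrite c4 c1 c2; split; field.
- rewrite (_ : 2 * pi * 3 / 5 = 6 * pi / 5); last by field.
  rewrite (_ : 2 * (6 * pi / 5) = 12 * pi / 5); last by field.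
  by rewrite c3 c6 c1 c2; split; field.
- rewrite (_ : 2 * pi * 4 / 5 = 8 * pi / 5); last by field.
  rewrite (_ : 2 * (8 * pi / 5) = 16 * pi / 5); last by field.
  by rewrite c4 c8 c1 c2; split; field.
Qed.

(** * Parity of the compressed entries and the residue modulo 4 *)

Lemma sum_sign_parity (R : realType) (m : nat) (f : nat -> R) :
  (forall i, f i = 1 \/ f i = -1) ->
  exists z : int, \sum_(i < m) f i = 2 * z%:~R + m%:R.
Proof.
move=> f_sign; elim: m => [|m [z IHm]].
  by exists 0; rewrite big_ord0 mulr0 addr0.
rewrite big_ord_recr /= IHm; case: (f_sign m) => ->.
  by exists z; rewrite -natr1; ring.
by exists (z - 1); rewrite -natr1 intrD; ring.
Qed.

Lemma compression_odd (R : realType) (n m : nat) (a : 'rV[R]_(n * m)) (k : 'I_n) :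
  odd m -> (forall i, a 0 i = 1 \/ a 0 i = -1) ->
  exists z : int, compression a 0 k = 2 * z%:~R + 1.
Proof.
move=> m_odd a_sign; rewrite mxE.
(* This excludes the default value 0 of [cyc], which is not a sign. *)
have nm_gt0 : (0 < n * m)%N by have := ltn_ord k; have := odd_gt0 m_odd; nia.
have [|z ->] := sum_sign_parity R m (fun i => cyc a (n * i + k)%N).
  by move=> i; exact: (cyc_ind _ _ _ (fun x => x = 1 \/ x = -1)).
exists (z + m./2%:Z); rewrite -{1}(odd_double_half m) m_odd -muln2 natrD natrM intrD.
by rewrite -pmulrn /=; ring.
Qed.

Lemma PAF5_1_mod4 (R : realType) (v : 'rV[R]_5) :
  (forall k, exists z : int, v 0 k = 2 * z%:~R + 1) ->
  \sum_(k < 5) v 0 k = 1 -> exists z : int, PAF v 1 = 4 * z%:~R + 1.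
Proof.
move=> v_odd; have cyc_odd k : exists z : int, cyc v k = 2 * z%:~R + 1.
  exact: (cyc_ind _ _ _ (fun x => exists z : int, x = 2 * z%:~R + 1)).
rewrite (sum_row5 _ v (fun=> id)) PAF5_1.
have [[[z0 ->] [z1 ->]] [z2 ->]] := (cyc_odd 0%N, cyc_odd 1%N, cyc_odd 2).
have [[z3 ->] [z4 ->]] := (cyc_odd 3, cyc_odd 4) => sum1.
(* The expansion is four times the sum of these products, plus four times the sum of the [z]s, plus
   5. The [z]s sum to -2, so the constant is -3 = 4 * (-1) + 1. *)
exists (z0 * z4 + z1 * z0 + z2 * z1 + z3 * z2 + z4 * z3 - 1).
rewrite !(intrD, intrM, intrN).
have -> : z4%:~R = - 2 - z0%:~R - z1%:~R - z2%:~R - z3%:~R :> R by lra.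
by ring.
Qed.

(** The two cosines are conjugate in sqrt 5, so their rational parts see only the sum of the two
    autocorrelations, which the squared total fixes as [(1 - p2 v) / 2]. *)
Lemma PSD5_sqrt5 (R : realType) (v : 'rV[R]_5) (r : nat) :
  \sum_(k < 5) v 0 k = 1 -> (1 <= r <= 4)%N ->
  PSD v r = (5 * p2 v - 1) / 4
    + (-1) ^+ (r %/ 2) * Num.sqrt 5 * ((PAF v 1 - PAF v 2) / 2).
Proof.
move=> sum1 r_bound; rewrite PSD5; have [-> ->] := cos_2pi5Mn R r r_bound.
have := sqr_sum5 _ v; rewrite sum1 => sqr_sum.
have -> : PAF v 2 = (1 - p2 v) / 2 - PAF v 1 by lra.
by field.
Qed.

Theorem proposition2 (R : realType) (m : nat) (a b : 'rV[R]_(5 * m))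
    (odd_l : odd (5 * m)) (ab_legendre : legendre_pair a b)
    (sum_a : \sum_(i < 5 * m) a 0 i = 1) (sum_b : \sum_(i < 5 * m) b 0 i = 1) :
  (exists x : nat,
    [/\ (x%:Z = - ((5 * m)%:Z + 1) %[mod 4])%Z,
        (- ((5 * m)%:Z + 1) = (5 * m)%:Z + 1 %[mod 4])%Z
      & (forall r : nat, (1 <= r <= 4)%N ->
           PSD a (r * m) = (5 * m)%:R + 1 + (-1) ^+ (r %/ 2) * Num.sqrt 5 * x%:R
        /\ PSD b (r * m) = (5 * m)%:R + 1 - (-1) ^+ (r %/ 2) * Num.sqrt 5 * x%:R)
        (* the two sequences of a Legendre pair may be interchanged *)
        \/
        (forall r : nat, (1 <= r <= 4)%N ->
           PSD b (r * m) = (5 * m)%:R + 1 + (-1) ^+ (r %/ 2) * Num.sqrt 5 * x%:R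
        /\ PSD a (r * m) = (5 * m)%:R + 1 - (-1) ^+ (r %/ 2) * Num.sqrt 5 * x%:R)])
  <->
  [/\ p2 (compression a) = PAF (compression a) ord0,
      PAF (compression a) ord0 = p2 (compression b),
      p2 (compression b) = PAF (compression b) ord0
    & PAF (compression b) ord0 = (4 * m + 1)%:R].
Proof.
have m_odd : odd m by move: odd_l; rewrite oddM.
have [a_sign b_sign PAFab _] := ab_legendre.
rewrite -!p2_PAF0.
have PSDE (c : 'rV[R]_(5 * m)) r : \sum_(i < 5 * m) c 0 i = 1 -> (1 <= r <= 4)%N ->
    PSD c (r * m) = (5 * p2 (compression c) - 1) / 4 + (-1) ^+ (r %/ 2)
      * Num.sqrt 5 * ((PAF (compression c) 1 - PAF (compression c) 2) / 2).
  move=> sum_c r_bound; rewrite PSD_compression ?odd_gt0 //.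
  apply: PSD5_sqrt5 => //.
  by rewrite sum_compression.
split=> [[x [_ _ PSDx]]|[_ p2AB _ p2B]].
  (* The terms in sqrt 5 at the frequencies [m] and [2 m] have opposite signs. *)
  have [PSDa PSDb] :
      PSD a (1 * m) + PSD a (2 * m) = 2 * ((5 * m)%:R + 1) /\
      PSD b (1 * m) + PSD b (2 * m) = 2 * ((5 * m)%:R + 1).
    case: PSDx => PSDx; have [//|-> ->] := PSDx 1%N; have [//|-> ->] := PSDx 2%N;
      by rewrite expr0 expr1; split; ring.
  move: PSDa PSDb; rewrite !PSDE // expr0 expr1 !natrM => PSDa PSDb.
  by rewrite natrD natrM; split=> //; lra.
rewrite natrD natrM in p2B; have p2A := etrans p2AB p2B.
have := PAFD_compression _ _ _ _ _ _ 2 PAFab isT.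
have := PAFD_compression _ _ _ _ _ _ 1 PAFab isT.
rewrite -mulr_natl => PAF1 PAF2.
have := sqr_sum5 _ (compression a); rewrite sum_compression sum_a => sqr_sum.
have [||z PAFz] := PAF5_1_mod4 _ (compression a).
- by move=> k; apply: compression_odd.
- by rewrite sum_compression.
(* With [p2] equal to 4 m + 1 the autocorrelations of each compression at 1 and 2 sum to -2 m, so
   half their difference is the first one plus [m]. *)
pose y : int := 4 * z + 1 + m%:Z.
have yE : y%:~R = PAF (compression a) 1 + m%:R.
  by rewrite PAFz /y !(intrD, intrM) -!pmulrn.
have yA : (PAF (compression a) 1 - PAF (compression a) 2) / 2 = y%:~R.
  by lra.
have yB : (PAF (compression b) 1 - PAF (compression b) 2) / 2 = - y%:~R.
  by lra.
(* Here [y] is m + 1, hence 5 m + 1, modulo 4; as [m] is odd this is even, so changes of sign do not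
   affect it modulo 4. *)
exists `|y|%N; split; [by rewrite /y; lia|by lia|].
rewrite natr_absz.
(* A negative [y] gives the alternative with [a] and [b] interchanged. *)
have [y_ge0|y_lt0] := lerP 0 y; [left|right] => r r_bound;
  rewrite !PSDE // yA yB p2A p2B natrM
    ?(ger0_norm y_ge0) ?(ltr0_norm y_lt0) ?mulrNz;
  by split; field.
Qed.
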